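(* Let $\mathcal{H}\neq\{0\}$ be a separable complex Hilbert space and let $\partial_e\mathcal{S}(\mathcal{H})$ be the set of one-dimensional orthogonal projections on $\mathcal{H}$. Then the weak topology $\mathcal{T}_0$ on $\partial_e\mathcal{S}(\mathcal{H})$ and the metric topology $\mathcal{T}_n$ on $\partial_e\mathcal{S}(\mathcal{H})$ are equal.
   Context: $\mathcal{T}_0$ is the coarsest topology on $\partial_e\mathcal{S}(\mathcal{H})$ such that all the functions $h_Q:\partial_e\mathcal{S}(\mathcal{H})\to\mathbb{R}$, $h_Q(P):=\mathrm{tr}\,PQ$, with $Q\in\partial_e\mathcal{S}(\mathcal{H})$, are continuous. $\mathcal{T}_n$ is the topology on $\partial_e\mathcal{S}(\mathcal{H})$ induced by the metric $\rho_n(P,Q):=\|P-Q\|$, where $\|\cdot\|$ is the operator norm. *)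

(* Defs.v *)
(* The complex numbers are R[i], for an arbitrary model R : realType of the reals. *)
From HB Require Import structures.
From mathcomp Require Import all_boot all_order all_algebra.
From mathcomp Require Import complex.
From mathcomp Require Import all_classical all_reals all_analysis.
From mathcomp Require summability.

Set Implicit Arguments.
Unset Strict Implicit.
Unset Printing Implicit Defensive.

Import Order.TTheory GRing.Theory Num.Theory.
Import numFieldNormedType.Exports.
Local Open Scope classical_set_scope.
Local Open Scope complex_scope.
Local Open Scope ring_scope.

Definition separable_space (T : topologicalType) : Prop :=
  exists2 S : set T, countable S & dense S.

Section operators.
Context {R : realType} {H : completeNormedModType R[i]}.
Implicit Types (A : H -> H) (dot : {dot H for Num.conj}).

(* Norms in a normed R[i]-module are R[i]-valued; their real part is taken to
   form a supremum in R. *)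
Definition opnorm A : R := sup [set complex.Re `|A x| | x in [set x | `|x| <= 1]].

(* H is a Hilbert space for dot when its norm is the one induced by dot
   (completeness is part of the type of H). *)
Definition norm_induced_by dot : Prop := forall x, `|x| ^+ 2 = dot x x.

Definition linear_span (B : set H) : set H :=
  [set x | exists (s : seq H) (c : H -> R[i]),
     [set` s] `<=` B /\ x = \sum_(b <- s) c b *: b].

Definition orthonormal_basis dot (B : set H) : Prop :=
  {in B &, forall u v, dot u v = (u == v)%:R} /\ dense (linear_span B).

(* The sum over a basis is the limit of the net of its finite partial sums, as
   a basis carries no order. *)
Definition has_trace dot A (t : R[i]) : Prop :=
  forall B : set H, orthonormal_basis dot B ->
    summability.partial_sum (fun b : B => dot (A (val b)) (val b) : R[i]^o)
      @ summability.totally --> (t : R[i]^o).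

(* The trace, with the junk value 0 for operators that have none. *)
Definition trace dot A : R[i] := xget 0 (has_trace dot A).

Definition orthogonal_projection dot A : Prop :=
  [/\ linear A, continuous A, A \o A = A
    & forall x y, dot (A x) y = dot x (A y)].

Definition one_dimensional (V : set H) : Prop :=
  exists2 v : H, v != 0 & V = [set c *: v | c in [set: R[i]]].

Definition pure_states dot : set (H -> H) :=
  [set P | orthogonal_projection dot P /\ one_dimensional (range P)].

Definition pure_state dot : Type := set_type (pure_states dot).

HB.instance Definition _ dot := Choice.on (pure_state dot).

Definition pure_state_fun dot (P : pure_state dot) : H -> H := val P.

Lemma pure_state_fun_linear dot (P : pure_state dot) :
  linear (pure_state_fun P).
Proof. by have [[]] := set_valP P. Qed.

HB.instance Definition _ dot (P : pure_state dot) :=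
  GRing.isLinear.Build _ _ _ _ (pure_state_fun P) (pure_state_fun_linear P).

Lemma pure_state_fun_continuous dot (P : pure_state dot) :
  continuous (pure_state_fun P).
Proof. by have [[]] := set_valP P. Qed.

End operators.

Coercion pure_state_fun : pure_state >-> Funclass.

Section topologies.
Context {R : realType} {H : completeNormedModType R[i]}.
Variable dot : {dot H for Num.conj}.
Implicit Types P Q : pure_state dot.

(* tr PQ is a nonnegative real number; Re only changes its type. *)
Definition transition_prob Q P : R := complex.Re (trace dot (P \o Q)).

(* The coarsest topology making every transition_prob Q continuous. *)
Definition weak_pure_state : Type :=
  sup_topology (fun Q =>
    Topological.class (initial_topology (transition_prob Q))).

HB.instance Definition _ := Topological.on weak_pure_state.

Definition rho P Q : R := opnorm (P \- Q).

Lemma pure_state_unit_ball_bounded P :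
  exists M : R, forall x, `|x| <= 1 -> complex.Re `|P x| <= M.
Proof.
have /linear_bounded_continuous/linear_boundedP bP :=
  @pure_state_fun_continuous _ _ dot P.
have [M [M0 bM]] := pinfty_ex_gt0 bP.
exists (complex.Re M) => x x1; have := bM x.
move=> /le_trans /(_ (ler_wpM2l (ltW M0) x1)).
by rewrite mulr1 lecE => /andP[].
Qed.

Let sup_set P Q := [set complex.Re `|(P \- Q) x| | x in [set x | `|x| <= 1]].

Let sup_set_has_sup P Q : has_sup (sup_set P Q).
Proof.
split; first by exists (complex.Re `|(P \- Q) 0|), 0 => //=; rewrite normr0.
have [M PM] := pure_state_unit_ball_bounded P.
have [N QN] := pure_state_unit_ball_bounded Q.
exists (M + N) => _ [x /= x1 <-].
have := ler_normB (P x) (Q x); rewrite lecE => /andP[_] /= /le_trans; apply.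
by rewrite raddfD lerD ?PM ?QN.
Qed.

Let le_rho P Q x : `|x| <= 1 -> complex.Re `|P x - Q x| <= rho P Q.
Proof.
by move=> x1; apply: (ub_le_sup (sup_set_has_sup P Q).2); exists x.
Qed.

Let rho_xx P : rho P P = 0.
Proof.
apply/eqP; rewrite eq_le; apply/andP; split.
  apply: ge_sup; first exact: (sup_set_has_sup P P).1.
  by move=> _ [x /= x1 <-]; rewrite subrr normr0.
by have := @le_rho P P 0; rewrite subrr !normr0 => ->.
Qed.

Let rho_positivity P Q : rho P Q = 0 -> P = Q.
Proof.
move=> PQ0.
have PQ1 x : `|x| <= 1 -> P x = Q x.
  move=> /(le_rho P Q); rewrite PQ0 => le0; apply/eqP; rewrite -subr_eq0 -normr_eq0.
  rewrite eq_le normr_ge0 andbT lecE /= le0 andbT.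
  by have := normr_ge0 (P x - Q x); rewrite lecE => /andP[/eqP -> _]; exact/eqP.
suff PQ : pure_state_fun P = pure_state_fun Q.
  exact: val_inj.
apply/funext => x.
have [->|x0] := eqVneq x 0; first by apply: PQ1; rewrite normr0.
have nx0 : `|x| != 0 by rewrite normr_eq0.
have -> : x = `|x| *: (`|x|^-1 *: x) by rewrite scalerA divff// scale1r.
rewrite [LHS]linearZ [RHS]linearZ; congr (_ *: _).
by apply: PQ1; rewrite normrZ normfV normr_id mulVf.
Qed.

Let rho_sym P Q : rho P Q = rho Q P.
Proof.
by rewrite /rho /opnorm; congr (sup _); apply: eq_imagel => x _; rewrite /= distrC.
Qed.

Let rho_triangle Q P S : rho P S <= rho P Q + rho Q S.
Proof.
apply: ge_sup; first exact: (sup_set_has_sup P S).1.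
move=> _ [x /= x1 <-]; apply: le_trans (lerD (le_rho P Q x1) (le_rho Q S x1)).
by rewrite -raddfD; have := ler_distD (Q x) (P x) (S x); rewrite lecE => /andP[].
Qed.

Definition metric_pure_state : Type := pure_state dot.

HB.instance Definition _ := Choice.on metric_pure_state.

HB.instance Definition _ := @isMetric.Build R metric_pure_state
  rho rho_xx rho_positivity rho_sym rho_triangle.

End topologies.

(* Main.v *)
(* Write P_p for the projection x |-> <x, p> p onto the line of a unit vector p.
   Parseval's identity gives tr (P P_q) = <P q, q>, so that
   |tr (P P_q) - tr (P' P_q)| <= ||P - P'||, and the weak topology is coarser than
   the metric one. Conversely,
     P_p x - P_q x = <x, p - P_q p> p - <x, q> (q - P_p q)
   and both residuals have squared norm 1 - |<p, q>|^2 = 1 - tr (P_p P_q), so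
   ||P_p - P_q|| <= 2 sqrt (1 - tr (P_p P_q)): the single weakly continuous
   function tr (P_p .), which is 1 at P_p, controls the distance to P_p. *)
Require Import Defs.
From HB Require Import structures.
From mathcomp Require Import all_boot all_order all_algebra.
From mathcomp Require Import complex.
From mathcomp Require Import all_classical all_reals all_analysis.
From mathcomp Require Import finmap lra.
From mathcomp Require summability.
Set Implicit Arguments.
Unset Strict Implicit.
Unset Printing Implicit Defensive.
Import Order.TTheory GRing.Theory Num.Theory.
Import numFieldNormedType.Exports.
Local Open Scope classical_set_scope.
Local Open Scope complex_scope.
Local Open Scope ring_scope.

(** * Cauchy-Schwarz, Fourier sums and Parseval's identity *)

Section hilbert.
Variables (R : realType) (H : completeNormedModType R[i]).
Variable dot : {dot H for Num.conj}.
Hypothesis H_hilbert : norm_induced_by dot.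
Implicit Types (x y z u v : H) (s t : seq H).

Lemma dotC u v : dot u v = (dot v u)^*.
Proof. by rewrite hermC expr0 mul1r. Qed.

Lemma cauchy_schwarz x y : `|dot x y| <= `|x| * `|y|.
Proof.
have [->|y0] := eqVneq y 0.
  by rewrite linear0r !normr0 mulr0.
have yy0 : 0 < `|y| ^+ 2 by rewrite exprn_gt0// normr_gt0.
rewrite -(@ler_pXn2r _ 2) ?nnegrE ?mulr_ge0// exprMn -ler_pdivrMr//.
(* The squared norm of the component of [x] orthogonal to [y] is nonnegative; expanding it gives the
   squared inequality. *)
have := dnorm_ge0 dot (x - (dot x y / dot y y) *: y).
set a := dot x y / dot y y.
have -> : dot (x - a *: y) (x - a *: y) = dot x x - `|dot x y| ^+ 2 / dot y y.
  have h : dot (x - a *: y) y = 0.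
    rewrite linearBl linearZl_LR /= /a divfK ?subrr//.
    by rewrite -H_hilbert gt_eqF.
  rewrite linearBr linearZr_LR /= h mulr0 subr0 linearBl linearZl_LR /=.
  by rewrite (dotC y x) /a mulrAC -normCK.
by rewrite subr_ge0 -!H_hilbert.
Qed.

Definition orthonormal_seq s := {in s &, forall u v, dot u v = (u == v)%:R}.

Definition fourier_sum s x := \sum_(b <- s) dot x b *: b.

Lemma dot_sumr_eq0 s (c : H -> R[i]) x :
  {in s, forall b, dot x b = 0} -> dot x (\sum_(b <- s) c b *: b) = 0.
Proof.
move=> x0; rewrite linear_sumr big1_seq// => b /andP[_ bs].
by rewrite linearZr_LR /= x0 ?mulr0.
Qed.

Lemma fourier_residual_orthogonal s x : uniq s -> orthonormal_seq s ->
  {in s, forall b, dot (x - fourier_sum s x) b = 0}.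
Proof.
move=> us os b bs; rewrite linearBl linear_sumlz (bigD1_seq b) //=.
rewrite linearZl_LR /= (os b b)// eqxx mulr1 big1_seq ?addr0 ?subrr//.
by move=> u /andP[ub us']; rewrite linearZl_LR /= (os u b)// (negPf ub) mulr0.
Qed.

(** Pythagoras: the Fourier residual is orthogonal to the span of [s], which contains the difference
    of the two approximants. *)
Lemma fourier_sum_best s t x (c : H -> R[i]) :
    uniq s -> orthonormal_seq s -> {subset t <= s} ->
  `|x - fourier_sum s x| <= `|x - \sum_(b <- t) c b *: b|.
Proof.
move=> us os ts; rewrite -(@ler_pXn2r _ 2) ?nnegrE//.
set y := fourier_sum s x; set z := \sum_(b <- t) _.
have xs := fourier_residual_orthogonal x us os.
rewrite !H_hilbert -(subrKA y x (- z)) [leRHS]hnormDd.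
  by rewrite lerDl dnorm_ge0.
have xy0 : dot (x - y) y = 0 by exact: dot_sumr_eq0.
have xz0 : dot (x - y) z = 0 by apply: dot_sumr_eq0 => b /ts; exact: xs.
by rewrite linearBr /= xy0 xz0 subrr.
Qed.

(** By density some finite combination of basis vectors is close to [x]. The Fourier sum over any
    larger finite set is at least as close, and Cauchy-Schwarz carries this over to the product with
    [y]. *)
Lemma parseval (B : set H) x y : orthonormal_basis dot B ->
  summability.partial_sum (fun b : B => dot x (val b) * dot (val b) y : R[i]^o)
    @ summability.totally --> (dot x y : R[i]^o).
Proof.
move=> [oB dB]; have tF := @summability.totally_filter B.
apply/cvgrPdist_lt => e e0.
have y1 : 0 < `|y| + 1 by rewrite ltr_wpDl.
have [|z [+ [s [c [sB zE]]]]] :=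
    dB (ball x (e / (`|y| + 1))) _ (ball_open _ _).
- by exists x; apply: ballxx; rewrite divr_gt0.
rewrite {}zE -ball_normE /= => xz.
exists [fset b in pmap insub s : seq B]%fset => // A /= sA.
set t := map val (enum_fset A).
have -> : summability.partial_sum
    (fun b : B => dot x (val b) * dot (val b) y : R[i]^o) A =
    dot (fourier_sum t x) y.
  rewrite /summability.partial_sum linear_sumlz big_map [RHS]big_seq_fsetE /=.
  by apply: eq_bigr => b _; rewrite linearZl_LR.
rewrite -linearBl (le_lt_trans (cauchy_schwarz _ _))//.
have tB b : b \in t -> b \in B.
  by move=> /mapP[b' _ ->]; exact: valP.
have ut : uniq t by rewrite map_inj_uniq ?fset_uniq//; exact: val_inj.
have ot : orthonormal_seq t by move=> u v /tB uB /tB vB; exact: oB.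
have st : {subset s <= t}.
  move=> b bs; have Bb : b \in B by exact/mem_set/sB.
  apply/mapP; exists (Sub b Bb); last by rewrite SubK.
  by apply: (fsubsetP sA); rewrite inE /= mem_pmap_sub SubK.
have := le_lt_trans (fourier_sum_best x c ut ot st) xz.
rewrite ltr_pdivlMr// => /(le_lt_trans _); apply.
by rewrite ler_wpM2l// lerDl.
Qed.

(** * Gram-Schmidt and the existence of an orthonormal basis *)

Definition gram_schmidt_step s x :=
  let r := x - fourier_sum s x in
  if r == 0 then s else (`|r|^-1 *: r) :: s.

Lemma gram_schmidt_step_orthonormal s x : uniq s -> orthonormal_seq s ->
  uniq (gram_schmidt_step s x) /\ orthonormal_seq (gram_schmidt_step s x).
Proof.
move=> us os; rewrite /gram_schmidt_step; set r := x - _.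
have [//|r0] := eqVneq r 0.
have rs b : b \in s -> dot (`|r|^-1 *: r) b = 0.
  by move=> bs; rewrite linearZl_LR /= fourier_residual_orthogonal ?mulr0.
have rr : dot (`|r|^-1 *: r) (`|r|^-1 *: r) = 1.
  by rewrite -H_hilbert normrZ normfV normr_id mulVf ?expr1n// normr_eq0.
have rNs : `|r|^-1 *: r \notin s.
  by apply/negP => /rs/eqP; rewrite rr oner_eq0.
split; first by rewrite /= rNs.
move=> u v; rewrite !inE => /predU1P[->|us'] /predU1P[->|vs].
- by rewrite eqxx rr.
- rewrite rs//; case: eqP => // rv; by rewrite rv vs in rNs.
- rewrite dotC rs// rmorph0; case: eqP => // ur; by rewrite -ur us' in rNs.
- exact: os.
Qed.

(** The residual [r] is orthogonal to [x - r], so the coefficient of [x] along the new unit vector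
    is [|r|] and the new term restores exactly [r]. *)
Lemma fourier_sum_gram_schmidt_step s x : uniq s -> orthonormal_seq s ->
  fourier_sum (gram_schmidt_step s x) x = x.
Proof.
move=> us os; rewrite /gram_schmidt_step; set r := x - _.
have [/eqP|r0] := eqVneq r 0; first by rewrite subr_eq0 => /eqP <-.
have rx : dot r (x - r) = 0.
  rewrite /r subKr dot_sumr_eq0// => b; exact: fourier_residual_orthogonal.
rewrite /fourier_sum big_cons -/(fourier_sum s x).
have -> : dot x (`|r|^-1 *: r) = `|r|.
  rewrite linearZr_LR /= -[in dot x r](subrK r x) linearDl /= -H_hilbert.
  rewrite dotC rx rmorph0 add0r fmorphV /= geC0_conj//.
  by rewrite expr2 mulKf// normr_eq0.
by rewrite scalerA divff ?normr_eq0// scale1r /r subrK.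
Qed.

Fixpoint gram_schmidt (d : nat -> H) n :=
  if n is m.+1 then gram_schmidt_step (gram_schmidt d m) (d m) else [::].

Lemma gram_schmidt_orthonormal d n :
  uniq (gram_schmidt d n) /\ orthonormal_seq (gram_schmidt d n).
Proof. by elim: n => [//|n [un on]]; exact: gram_schmidt_step_orthonormal. Qed.

Lemma sub_gram_schmidt d m n : (m <= n)%N ->
  {subset gram_schmidt d m <= gram_schmidt d n}.
Proof.
elim: n => [|n IHn]; first by rewrite leqn0 => /eqP ->.
rewrite leq_eqVlt ltnS => /predU1P[->//|/IHn mn] b /mn bn /=.
by rewrite /gram_schmidt_step; case: ifP => // _; rewrite inE bn orbT.
Qed.

(* Needed because [has_trace] quantifies over all orthonormal bases: without one,
   every number would be a trace. *)
Lemma exists_orthonormal_basis : separable_space H ->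
  exists B : set H, orthonormal_basis dot B.
Proof.
move=> [D /countable_injP[f fD] dD].
(* [d] inverts the injection [f] on [D]. Its default 0 is harmless: the residual of 0 is 0, so
   Gram-Schmidt skips it. *)
pose d n := xget 0 [set x | D x /\ f x = n].
have dD' x : D x -> d (f x) = x.
  move=> Dx; rewrite /d; case: xgetP => [y _ [Dy fy]|/(_ x)]; last by case.
  by apply: fD => //; exact/mem_set.
exists [set x | exists n, x \in gram_schmidt d n]; split.
  move=> u v /set_mem[m um] /set_mem[n vn].
  apply: (gram_schmidt_orthonormal d (maxn m n)).2.
    exact: sub_gram_schmidt (leq_maxl _ _) _ um.
  exact: sub_gram_schmidt (leq_maxr _ _) _ vn.
move=> O O0 oO; have [x [Ox Dx]] := dD _ O0 oO.
(* The vector [x = d (f x)] is processed in passing from stage [f x] to its successor, where it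
   equals its own Fourier sum. *)
exists x; split => //; exists (gram_schmidt d (f x).+1), (dot x); split.
  by move=> b /= bx; exists (f x).+1.
have [us os] := gram_schmidt_orthonormal d (f x).
by have := fourier_sum_gram_schmidt_step x us os; rewrite -{2}(dD' x Dx).
Qed.

End hilbert.

(** * Pure states as rank-one projections, and their traces *)

Section pure_states.
Variables (R : realType) (H : completeNormedModType R[i]).
Variable dot : {dot H for Num.conj}.
Hypothesis H_hilbert : norm_induced_by dot.
Implicit Types (x y z u v p q : H) (P Q : pure_state dot).

(** For a unit vector [p] of the range, [P p = p] by idempotence, and self-adjointness gives the
    coefficient: <P x, p> = <x, P p> = <x, p>. *)
Lemma pure_stateP P : exists p, `|p| = 1 /\ forall x, P x = dot x p *: p.
Proof.
have [[linP ctsP PP symP] [v v0 rP]] := set_valP P.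
have nv0 : `|v| != 0 by rewrite normr_eq0.
pose p := `|v|^-1 *: v.
have p1 : `|p| = 1 by rewrite normrZ normfV normr_id mulVf.
have pp : dot p p = 1 by rewrite -H_hilbert p1 expr1n.
have rangeP x : exists c, P x = c *: p.
  have : range (val P) (P x) by exists x.
  rewrite rP => -[c _ <-]; exists (c * `|v|).
  by rewrite scalerA mulfK.
have Pp : P p = p.
  have : range (val P) p by rewrite rP; exists `|v|^-1.
  move=> [y _ <-]; exact: (congr1 (@^~ y) PP).
exists p; split => // x; have [c Pxc] := rangeP x.
suff -> : dot x p = c by [].
have := symP x p; rewrite -/(pure_state_fun P x) -/(pure_state_fun P p) Pp => <-.
by rewrite Pxc linearZl_LR /= pp mulr1.
Qed.

Section trace.
Hypothesis H_separable : separable_space H.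

(** Since P (Q b) = <b, q> P q, the diagonal terms in any basis are the Parseval terms of <P q,
    q>. *)
Lemma trace_comp_pure_state P Q q : (forall x, Q x = dot x q *: q) ->
  trace dot (P \o Q) = dot (P q) q.
Proof.
move=> Qq; have tF B := @summability.totally_filter B.
have trPQ : has_trace dot (P \o Q) (dot (P q) q).
  move=> B oB.
  have -> : (fun b : B => dot ((P \o Q) (val b)) (val b) : R[i]^o) =
      (fun b : B => dot (P q) (val b) * dot (val b) q).
    by apply/funext => b; rewrite /= Qq linearZ linearZl_LR mulrC.
  exact: parseval.
have [B oB] := exists_orthonormal_basis H_hilbert H_separable.
apply: xget_unique => // t /(_ B oB) trt.
exact: (cvg_unique _ trt (trPQ B oB)).
Qed.

Lemma transition_probE P Q q : (forall x, Q x = dot x q *: q) ->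
  transition_prob Q P = complex.Re (dot (P q) q).
Proof. by move=> Qq; rewrite /transition_prob (trace_comp_pure_state _ Qq). Qed.

End trace.

(** * Estimates between the operator distance and the transition probability *)

Lemma norm_pure_state_le P x : `|P x| <= `|x|.
Proof.
have [p [p1 Pp]] := pure_stateP P.
rewrite Pp normrZ p1 mulr1 (le_trans (cauchy_schwarz H_hilbert _ _))//.
by rewrite p1 mulr1.
Qed.

Lemma Re_le_norm (z : R[i]) : `|complex.Re z| <= complex.Re `|z|.
Proof.
by rewrite -lecR normc_ge_Re.
Qed.

Lemma le_Re (z w : R[i]) : z <= w -> complex.Re z <= complex.Re w.
Proof. by rewrite lecE => /andP[]. Qed.

Lemma le_rho P Q x : `|x| <= 1 -> complex.Re `|P x - Q x| <= rho P Q.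
Proof.
move=> x1; apply: ub_le_sup; last by exists x.
(* Both projections are contractions, so 2 bounds the set whose supremum is [rho]. *)
exists (1 + 1) => _ [y /= y1 <-]; apply: (@le_Re _ (1 + 1)).
rewrite (le_trans (ler_normB _ _))// lerD// (le_trans _ y1)//;
  exact: norm_pure_state_le.
Qed.

Lemma rho_le_bound P Q (M : R) :
  (forall x, `|x| <= 1 -> `|P x - Q x| <= M%:C) -> rho P Q <= M.
Proof.
move=> PQM; apply: ge_sup.
  by exists (complex.Re `|P 0 - Q 0|), 0 => //=; rewrite normr0.
by move=> _ [x /= x1 <-]; exact/(le_Re (PQM x x1)).
Qed.

Hypothesis H_separable : separable_space H.

Lemma transition_prob_lipschitz P P' Q :
  `|transition_prob Q P - transition_prob Q P'| <= rho P P'.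
Proof.
have [q [q1 Qq]] := pure_stateP Q.
rewrite !(transition_probE H_separable _ Qq) -raddfB -linearBl.
have /le_trans := Re_le_norm (dot (P q - P' q) q); apply.
apply: le_trans (@le_rho P P' q _); last by rewrite q1.
by apply: le_Re; rewrite (le_trans (cauchy_schwarz H_hilbert _ _))// q1 mulr1.
Qed.

Lemma norm_unit_residual p q : `|p| = 1 -> `|q| = 1 ->
  `|p - dot p q *: q| ^+ 2 = 1 - `|dot p q| ^+ 2.
Proof.
move=> p1 q1.
have pp : dot p p = 1 by rewrite -H_hilbert p1 expr1n.
have qq : dot q q = 1 by rewrite -H_hilbert q1 expr1n.
rewrite H_hilbert linearBr linearZr_LR /= !linearBl !linearZl_LR /= qq mulr1 subrr.
by rewrite mulr0 subr0 pp (dotC _ q p) -normCK.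
Qed.

Lemma rho_le_transition_prob P Q (e : R) : 0 <= e ->
  1 - transition_prob P Q <= e ^+ 2 -> rho P Q <= e *+ 2.
Proof.
have [p [p1 Pp]] := pure_stateP P; have [q [q1 Qq]] := pure_stateP Q.
move=> e0; rewrite (transition_probE H_separable _ Pp) Qq linearZl_LR /=.
rewrite (dotC _ q p) -normCK => pqe.
(* Stated for general [u], [v] so as to serve both residuals: [p] against [q] and [q] against
   [p]. *)
have residual_le u v : `|u| = 1 -> `|v| = 1 -> `|dot u v| = `|dot p q| ->
    `|u - dot u v *: v| <= e%:C.
  move=> u1 v1 uv; rewrite -(@ler_pXn2r _ 2) ?nnegrE// ?lecR//.
  rewrite norm_unit_residual// uv -[leRHS]rmorphXn.
  (* The squared modulus is a real number embedded in [R[i]], so the comparison descends to [R]. *)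
  have -> : 1 - `|dot p q| ^+ 2 = (1 - complex.Re (`|dot p q| ^+ 2))%:C.
    by rewrite rmorphB -add_Re2_Im2.
  by rewrite lecR.
apply: rho_le_bound => x x1.
have dotx u : `|dot x u| <= `|u|.
  rewrite (le_trans (cauchy_schwarz H_hilbert _ _))//.
  by rewrite ler_piMl.
(* The terms <x, q><q, p> p cancel between the two summands; each remaining factor is a residual or
   has norm at most 1. *)
have -> : P x - Q x = dot x (p - dot p q *: q) *: p - dot x q *: (q - dot q p *: p).
  rewrite Pp Qq linearBr linearZr_LR /= -(dotC _ q p) scalerBl scalerBr scalerA.
  by rewrite [_ * dot x q]mulrC opprB addrA subrK.
rewrite (le_trans (ler_normB _ _))// !normrZ p1 mulr1 mulr2n rmorphD lerD//.
  exact: le_trans (dotx _) (residual_le _ _ _ _ _).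
rewrite -[leRHS]mul1r ler_pM//; first by rewrite -q1.
by apply: residual_le => //; rewrite dotC norm_conjC.
Qed.

(** * Continuity of the transition probabilities and comparison of the topologies *)

Lemma transition_prob_continuous_metric Q (P : metric_pure_state dot) :
  transition_prob Q @ nbhs P --> transition_prob Q P.
Proof.
apply/cvgrPdist_lt => e e0; apply/nbhs_ballP; exists e => //= P' PP'.
exact: le_lt_trans (transition_prob_lipschitz _ _ _) PP'.
Qed.

Lemma transition_prob_continuous_weak Q :
  continuous (transition_prob Q : weak_pure_state dot -> R).
Proof.
move=> P; have /cvg_sup/(_ Q) cvgQ : nbhs (P : weak_pure_state dot) --> P by [].
exact: cvg_trans (cvg_app _ cvgQ) (@initial_continuous _ _ (transition_prob Q) P).
Qed.

Lemma transition_prob_xx P : transition_prob P P = 1.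
Proof.
have [p [p1 Pp]] := pure_stateP P.
rewrite (transition_probE H_separable _ Pp) Pp linearZl_LR /=.
by rewrite -H_hilbert p1 expr1n mulr1.
Qed.

End pure_states.

Theorem theorem4 (R : realType) (H : completeNormedModType R[i])
    (dot : {dot H for Num.conj})
    (H_hilbert : norm_induced_by dot)
    (H_separable : separable_space H)
    (H_nonzero : exists x : H, x != 0) :
  [set U : set (pure_state dot) | open (U : set (weak_pure_state dot))] =
  [set U : set (pure_state dot) | open (U : set (metric_pure_state dot))].
Proof.
apply/seteqP; split => U /=; rewrite !openE => oU P UP.
  suff cvgP : nbhs (P : metric_pure_state dot) --> (P : weak_pure_state dot).
    exact: cvgP (oU P UP).
  (* Convergence in a supremum topology is tested on each component, hence on preimages of open [V]
     under one [transition_prob Q]. *)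
  apply/cvg_sup => Q A [_ [[V oV <-] VP VA]]; apply: filterS VA _.
  apply: (transition_prob_continuous_metric H_hilbert H_separable).
  exact: open_nbhs_nbhs.
have /nbhs_ballP[e /= e0 eU] := oU P UP.
(* A defect 1 - tr(P P') below the square of [e / 3] bounds the distance by twice [e / 3], which is
   strictly less than [e]. *)
have e3 : 0 < e / 3 by rewrite divr_gt0.
have /cvgrPdist_lt/(_ _ (exprn_gt0 2 e3)) nearP :=
  @transition_prob_continuous_weak _ _ dot P P.
apply: filterS nearP => P'; rewrite transition_prob_xx// => PP'; apply: eU.
apply: (@le_lt_trans _ _ ((e / 3) *+ 2)); last by lra.
apply: rho_le_transition_prob => //; first exact: ltW.
exact: le_trans (ler_norm _) (ltW PP').
Qed.
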